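(* Let $M,N$ be complete pointed metric spaces and let $f\in \mathrm{Lip}_0(M,N)$ be such that $\widehat f$ is injective. Then $f$ preserves the support of every $\gamma\in\mathcal F(M)$ such that $\operatorname{supp}(\gamma)$ is bounded. In particular, if $M$ is bounded, then for $f\in \mathrm{Lip}_0(M,N)$ the operator $\widehat f$ is injective if and only if $f$ preserves supports.
   Context: A pointed metric space is a metric space with a distinguished base point $0$. $\mathrm{Lip}_0(M,N)$ is the set of Lipschitz maps $f\colon M\to N$ with $f(0)=0$; $\mathrm{Lip}_0(M)=\mathrm{Lip}_0(M,\mathbb R)$ is a Banach space for the norm $\|f\|_L$ = best Lipschitz constant of $f$. For $x\in M$, $\delta(x)\in \mathrm{Lip}_0(M)^*$ is the evaluation $\langle f,\delta(x)\rangle=f(x)$. The Lipschitz-free space $\mathcal F(M)$ is the norm-closed linear span of $\{\delta(x):x\in M\}$ in $\mathrm{Lip}_0(M)^*$. For $f\in \mathrm{Lip}_0(M,N)$, $\widehat f\colon \mathcal F(M)\to\mathcal F(N)$ is the unique bounded linear operator with $\widehat f(\delta(x))=\delta(f(x))$ for all $x\in M$. For $K\subset M$ containing $0$, $\mathcal F(K)$ is identified with the closed linear span of $\{\delta(x):x\in K\}$ in $\mathcal F(M)$. The support $\operatorname{supp}(\mu)$ of $\mu\in\mathcal F(M)$ is the intersection of all closed sets $K\subset M$ with $\mu\in\mathcal F(K\cup\{0\})$. $f\in \mathrm{Lip}_0(M,N)$ preserves the support of $\mu\in\mathcal F(M)$ if $\operatorname{supp}(\widehat f(\mu))=\overline{f(\operatorname{supp}(\mu))}$;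 $f$ preserves supports if it preserves the support of every $\mu\in\mathcal F(M)$. *)

(* Defs.v *)
From HB Require Import structures.
From mathcomp Require Import all_boot all_order all_algebra.
From mathcomp Require Import all_classical all_reals all_analysis.

Set Implicit Arguments.
Unset Strict Implicit.
Unset Printing Implicit Defensive.

Import Order.TTheory GRing.Theory Num.Theory.
Import numFieldNormedType.Exports.

Local Open Scope classical_set_scope.
Local Open Scope ring_scope.

(** The base point of a pointed metric space is [point]; on [R^o] it is 0. *)
#[short(type="pointedMetricType")]
HB.structure Definition PointedMetric (R : numDomainType) :=
  {M of Metric R M & isPointed M}.

#[short(type="completePointedMetricType")]
HB.structure Definition CompletePointedMetric (R : numDomainType) :=
  {M of Complete M & Metric R M}.

HB.instance Definition _ (R : numFieldType) := Metric.on R^o.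

Definition metric_bounded (R : realType) (M : metricType R) (A : set M) :=
  exists r : R, forall x y, A x -> A y -> mdist x y <= r.

Definition Lip0 (R : realType) (M N : pointedMetricType R) : set (M -> N) :=
  [set f | (exists k : R, forall x y, mdist (f x) (f y) <= k * mdist x y)
           /\ f point = point].

Section best_constant.
Context {R : realType} {I : Type}.
Implicit Types a b : I -> R.

(** The least [k >= 0] such that [a <= k b] pointwise. *)
Definition best_constant a b : R :=
  inf [set k | 0 <= k /\ forall i, a i <= k * b i].

Lemma best_constant_ge0 a b : 0 <= best_constant a b.
Proof.
rewrite /best_constant; set B := [set _ | _].
have [->|/set0P B0] := eqVneq B set0; first by rewrite inf0.
by apply: lb_le_inf => // k [].
Qed.

Lemma best_constant_le a b k :
  0 <= k -> (forall i, a i <= k * b i) -> best_constant a b <= k.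
Proof. by move=> k0 H; apply: ge_inf => //; exists 0 => j []. Qed.

Lemma best_constantP a b : (forall i, 0 <= b i) ->
  (exists k, forall i, a i <= k * b i) ->
  forall i, a i <= best_constant a b * b i.
Proof.
move=> b0 [k kP] i; have [bi0|bi_neq0] := eqVneq (b i) 0.
  by have := kP i; rewrite bi0 !mulr0.
have bi_gt0 : 0 < b i by rewrite lt_neqAle eq_sym bi_neq0 b0.
rewrite -ler_pdivrMr//; apply: lb_le_inf.
  exists (Num.max k 0); split; first by rewrite le_max lexx orbT.
  by move=> j; rewrite (le_trans (kP j))// ler_wpM2r// le_max lexx.
by move=> l [_ lP]; rewrite ler_pdivrMr.
Qed.

End best_constant.

Section lip0_space.
Context (R : realType) (M : pointedMetricType R).

Definition lip0_pred : {pred (M -> R^o)} := mem (@Lip0 R M R^o).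

Record lip0 := MkLip0 { lip0_fun :> M -> R^o ; _ : lip0_fun \in lip0_pred }.

HB.instance Definition _ := [isSub for lip0_fun].
HB.instance Definition _ := [Choice of lip0 by <:].

Lemma lip0_submod_closed : submod_closed lip0_pred.
Proof.
split.
  apply/mem_set; split => //; exists 0 => x y.
  by rewrite mul0r mdistxx.
move=> c f g /set_mem[[k kP] f0] /set_mem[[l lP] g0]; apply/mem_set; split.
  exists (`|c| * k + l) => x y; rewrite /mdist/= mulrDl -mulrA.
  rewrite !fctE opprD addrACA -scalerBr (le_trans (ler_normD _ _))//.
  by rewrite lerD// ?lP// normrM ler_wpM2l// kP.
by move: f0 g0; rewrite !fctE /point/= => -> ->; rewrite scaler0 addr0.
Qed.

HB.instance Definition _ :=
  GRing.isSubmodClosed.Build R (M -> R^o) lip0_pred lip0_submod_closed.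
HB.instance Definition _ := [SubChoice_isSubLmodule of lip0 by <:].

Definition lip_norm (f : lip0) : R :=
  best_constant (fun xy : M * M => mdist (f xy.1) (f xy.2))
                (fun xy => mdist xy.1 xy.2).

Lemma lip0P (f : lip0) : Lip0 f.
Proof. by case: f => f fP; exact/set_mem. Qed.

Lemma lip0_point (f : lip0) : f point = 0.
Proof. by have [] := lip0P f. Qed.

Lemma lip_normP (f : lip0) x y : `|f x - f y| <= lip_norm f * mdist x y.
Proof.
rewrite distrC; apply: (@best_constantP R (M * M)%type _ _ _ _ (x, y)).
  by move=> xy; exact: mdist_ge0.
by have [[k kP] _] := lip0P f; exists k => xy; exact: kP.
Qed.

Lemma lip_norm_le (f : lip0) k : 0 <= k ->
  (forall x y, `|f x - f y| <= k * mdist x y) -> lip_norm f <= k.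
Proof.
by move=> k0 H; apply: best_constant_le => // xy; rewrite /mdist/= distrC.
Qed.

Let lip_normD (f g : lip0) : lip_norm (f + g) <= lip_norm f + lip_norm g.
Proof.
apply: lip_norm_le; first by rewrite addr_ge0// best_constant_ge0.
move=> x y; rewrite /= !fctE opprD addrACA (le_trans (ler_normD _ _))//.
by rewrite mulrDl lerD// lip_normP.
Qed.

Let lip_normZ_le c (f : lip0) : lip_norm (c *: f) <= `|c| * lip_norm f.
Proof.
apply: lip_norm_le; first by rewrite mulr_ge0// best_constant_ge0.
move=> x y; rewrite /= !fctE -scalerBr normrM -mulrA.
by rewrite ler_wpM2l// lip_normP.
Qed.

Let lip_normZ c (f : lip0) : lip_norm (c *: f) = `|c| * lip_norm f.
Proof.
apply/eqP; rewrite eq_le lip_normZ_le/=.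
have [->|c0] := eqVneq c 0; first by rewrite normr0 mul0r best_constant_ge0.
rewrite -ler_pdivlMl ?normr_gt0// -normfV.
by rewrite -{1}[f]scale1r -(mulVf c0) -scalerA lip_normZ_le.
Qed.

Let lip_norm_eq0 (f : lip0) : lip_norm f = 0 -> f = 0.
Proof.
move=> f0; apply/val_inj/funext => x /=; apply/eqP; rewrite -normr_le0.
by have := lip_normP f x point; rewrite f0 mul0r lip0_point subr0.
Qed.

HB.instance Definition _ :=
  Lmodule_isNormed.Build R lip0 lip_normD lip_normZ lip_norm_eq0.

End lip0_space.

Arguments lip0_pred {R} M.

Section dual_space.
Context (R : realType) (V : normedModType R).

Definition dual_pred : {pred (V -> R^o)} :=
  mem [set phi : V -> R^o | linear phi /\
        exists k : R, forall v, `|phi v| <= k * `|v|].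

Record dual := MkDual { dual_fun :> V -> R^o ; _ : dual_fun \in dual_pred }.

HB.instance Definition _ := [isSub for dual_fun].
HB.instance Definition _ := [Choice of dual by <:].

Lemma dual_submod_closed : submod_closed dual_pred.
Proof.
split.
  apply/mem_set; split; first by move=> c u v; rewrite scaler0 addr0.
  by exists 0 => v; rewrite mul0r normr0.
move=> c f g /set_mem[fl [k kP]] /set_mem[gl [l lP]]; apply/mem_set; split.
  move=> d u v; rewrite !fctE fl gl !scalerDr !scalerA addrACA.
  by rewrite (mulrC c d).
exists (`|c| * k + l) => v; rewrite mulrDl -mulrA !fctE.
rewrite (le_trans (ler_normD _ _))// lerD//.
by rewrite normrM ler_wpM2l.
Qed.

HB.instance Definition _ :=
  GRing.isSubmodClosed.Build R (V -> R^o) dual_pred dual_submod_closed.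
HB.instance Definition _ := [SubChoice_isSubLmodule of dual by <:].

Lemma dual_linear (phi : dual) : linear phi.
Proof. by case: phi => phi /= /set_mem[]. Qed.

HB.instance Definition _ (phi : dual) :=
  GRing.isLinear.Build R V R^o *:%R (dual_fun phi) (dual_linear phi).

Definition dual_norm (phi : dual) : R :=
  best_constant (fun v : V => `|phi v|) (fun v => `|v|).

Lemma dual_normP (phi : dual) v : `|phi v| <= dual_norm phi * `|v|.
Proof.
apply: (@best_constantP R V) => //.
by case: phi => phi /= /set_mem[].
Qed.

Lemma dual_norm_le (phi : dual) k : 0 <= k ->
  (forall v, `|phi v| <= k * `|v|) -> dual_norm phi <= k.
Proof. exact: best_constant_le. Qed.

Let dual_normD (f g : dual) : dual_norm (f + g) <= dual_norm f + dual_norm g.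
Proof.
apply: dual_norm_le; first by rewrite addr_ge0// best_constant_ge0.
move=> v; rewrite /= !fctE (le_trans (ler_normD _ _))//.
by rewrite mulrDl lerD// dual_normP.
Qed.

Let dual_normZ_le c (f : dual) : dual_norm (c *: f) <= `|c| * dual_norm f.
Proof.
apply: dual_norm_le; first by rewrite mulr_ge0// best_constant_ge0.
move=> v; rewrite /= !fctE normrM -mulrA.
by rewrite ler_wpM2l// dual_normP.
Qed.

Let dual_normZ c (f : dual) : dual_norm (c *: f) = `|c| * dual_norm f.
Proof.
apply/eqP; rewrite eq_le dual_normZ_le/=.
have [->|c0] := eqVneq c 0; first by rewrite normr0 mul0r best_constant_ge0.
rewrite -ler_pdivlMl ?normr_gt0// -normfV.
by rewrite -{1}[f]scale1r -(mulVf c0) -scalerA dual_normZ_le.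
Qed.

Let dual_norm_eq0 (f : dual) : dual_norm f = 0 -> f = 0.
Proof.
move=> f0; apply/val_inj/funext => v /=; apply/eqP; rewrite -normr_le0.
by have := dual_normP f v; rewrite f0 mul0r.
Qed.

HB.instance Definition _ :=
  Lmodule_isNormed.Build R dual dual_normD dual_normZ dual_norm_eq0.

End dual_space.

Arguments dual_pred {R} V.

Definition lin_span (R : realType) (V : lmodType R) (A : set V) : set V :=
  [set v | exists (n : nat) (c : 'I_n -> R) (w : 'I_n -> V),
     (forall i, A (w i)) /\ v = \sum_(i < n) c i *: w i].

Definition closed_span (R : realType) (V : normedModType R) (A : set V) :=
  closure (lin_span A).

Section spans.
Context (R : realType) (V : normedModType R).
Implicit Type A : set V.

Lemma lin_span_sub A : A `<=` lin_span A.
Proof.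
move=> v Av; exists 1%N, (fun=> 1), (fun=> v); split => //.
by rewrite big_ord1 scale1r.
Qed.

Lemma lin_span0 A : lin_span A 0.
Proof.
by exists 0%N, (fun=> 0), (fun=> 0); split; [case|rewrite big_ord0].
Qed.

Lemma lin_span_comb A c u v :
  lin_span A u -> lin_span A v -> lin_span A (c *: u + v).
Proof.
move=> [n [a [w [Aw ->]]]] [m [b [z [Az ->]]]].
exists (n + m)%N.
exists (fun i =>
  match fintype.split i with inl j => c * a j | inr j => b j end).
exists (fun i => match fintype.split i with inl j => w j | inr j => z j end).
split.
  by move=> i; case: (fintype.split i).
rewrite big_split_ord/= scaler_sumr; congr (_ + _); apply: eq_bigr => i _.
  by rewrite (unsplitK (inl i : 'I_n + 'I_m)) scalerA.
by rewrite (unsplitK (inr i : 'I_n + 'I_m)).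
Qed.

Lemma closed_spanP A v :
  closed_span A v <->
  forall e : R, 0 < e -> exists2 w, lin_span A w & `|v - w| < e.
Proof.
split=> [Av e e0|H B /nbhs_ballP[e e0 eB]].
  have [w [Aw]] := Av _ (nbhsx_ballx v e e0).
  by rewrite -ball_normE => vw; exists w.
have [w Aw vw] := H e e0; exists w; split => //; apply: eB.
by rewrite -ball_normE.
Qed.

Lemma closed_span_submod_closed A : submod_closed (mem (closed_span A)).
Proof.
split.
  by apply/mem_set; apply: subset_closure; exact: lin_span0.
move=> c u v /set_mem/closed_spanP uA /set_mem/closed_spanP vA.
apply/mem_set/closed_spanP => e e0.
have c1 : 0 < `|c| + 1 by rewrite ltr_wpDl.
have [u' Au' uu'] := uA (e / 2 / (`|c| + 1)) ltac:(by rewrite !divr_gt0).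
have [v' Av' vv'] := vA (e / 2) ltac:(by rewrite divr_gt0).
exists (c *: u' + v'); first exact: lin_span_comb.
rewrite opprD addrACA -scalerBr (le_lt_trans (ler_normD _ _))//.
rewrite [ltRHS](splitr e) ler_ltD// normrZ.
rewrite ltr_pdivlMr// in uu'; apply: le_trans (ltW uu').
by rewrite mulrC ler_wpM2l// lerDl.
Qed.

End spans.

Section lipfree_space.
Context (R : realType) (M : pointedMetricType R).

Lemma eval_lip0_dual (x : M) :
  (fun f : lip0 M => f x : R^o) \in dual_pred (lip0 M).
Proof.
apply/mem_set; split=> //; exists (mdist x point) => f.
by have := lip_normP f x point; rewrite lip0_point subr0 mulrC.
Qed.

Definition eval_lip0 (x : M) : dual (lip0 M) := MkDual (eval_lip0_dual x).

Definition lipfree_pred : {pred (dual (lip0 M))} :=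
  mem (closed_span (range eval_lip0)).

Record lipfree := MkFree {
  lipfree_val :> dual (lip0 M) ; _ : lipfree_val \in lipfree_pred }.

HB.instance Definition _ := [isSub for lipfree_val].
HB.instance Definition _ := [Choice of lipfree by <:].

HB.instance Definition _ := GRing.isSubmodClosed.Build R (dual (lip0 M))
  lipfree_pred (@closed_span_submod_closed R (dual (lip0 M)) (range eval_lip0)).
HB.instance Definition _ := [SubChoice_isSubLmodule of lipfree by <:].

Let lipfree_norm (mu : lipfree) : R := `|lipfree_val mu|.

Let lipfree_normD (m n : lipfree) :
  lipfree_norm (m + n) <= lipfree_norm m + lipfree_norm n.
Proof. exact: ler_normD. Qed.

Let lipfree_normZ c (m : lipfree) :
  lipfree_norm (c *: m) = `|c| * lipfree_norm m.
Proof. exact: normrZ. Qed.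

Let lipfree_norm_eq0 (m : lipfree) : lipfree_norm m = 0 -> m = 0.
Proof. by move=> /normr0_eq0 m0; exact/val_inj. Qed.

HB.instance Definition _ :=
  Lmodule_isNormed.Build R lipfree lipfree_normD lipfree_normZ lipfree_norm_eq0.

Lemma eval_lip0_lipfree x : eval_lip0 x \in lipfree_pred.
Proof. by apply/mem_set/subset_closure/lin_span_sub; exists x. Qed.

Definition delta (x : M) : lipfree := MkFree (eval_lip0_lipfree x).

(** [lipfree_on K] is the copy of F(K) inside F(M), for K containing the base
    point. *)
Definition lipfree_on (K : set M) : set lipfree := closed_span (delta @` K).

Definition supp (mu : lipfree) : set M :=
  \bigcap_(K in [set K | closed K /\ lipfree_on (K `|` [set point]) mu]) K.

End lipfree_space.

Arguments lipfree_pred {R} M.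

Section linearization.
Context (R : realType) (M N : pointedMetricType R).

Definition is_linearization (f : M -> N) (T : lipfree M -> lipfree N) :=
  [/\ linear T,
      exists k : R, forall mu, `|T mu| <= k * `|mu|
    & forall x, T (delta x) = delta (f x)].

(** The linearization exists and is unique when [Lip0 f], see
    [fhat_is_linearization] and [fhat_unique]; the value is junk otherwise. *)
Definition fhat (f : M -> N) : lipfree M -> lipfree N :=
  xget (fun=> 0) [set T | is_linearization f T].

Section existence.
Variables (f : M -> N) (f0 : Lip0 f).

Lemma comp_lip0_pred (g : lip0 N) : (g \o f : M -> R^o) \in lip0_pred M.
Proof.
have [[k kP] fp] := f0; apply/mem_set; split; last first.
  by rewrite /= fp lip0_point.
exists (lip_norm g * k) => x y; rewrite /mdist/= distrC -mulrA.
rewrite (le_trans (lip_normP g _ _))// ler_wpM2l//.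
exact: best_constant_ge0.
Qed.

Definition comp_lip0 (g : lip0 N) : lip0 M := MkLip0 (comp_lip0_pred g).

Lemma comp_lip0_norm :
  exists2 k : R, 0 <= k & forall g : lip0 N, `|comp_lip0 g| <= k * `|g|.
Proof.
have [[k kP] _] := f0; exists `|k| => // g.
apply: lip_norm_le; first by rewrite mulr_ge0.
move=> x y /=; rewrite (le_trans (lip_normP g _ _))// (mulrC `|k|) -mulrA.
rewrite ler_wpM2l ?best_constant_ge0// (le_trans (kP x y))//.
by rewrite ler_wpM2r ?mdist_ge0// ler_norm.
Qed.

Lemma pushforward_dual (phi : dual (lip0 M)) :
  (fun g : lip0 N => phi (comp_lip0 g) : R^o) \in dual_pred (lip0 N).
Proof.
apply/mem_set; split=> [c g h|].
  by rewrite -dual_linear; congr (dual_fun phi _); exact/val_inj.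
have [k k0 kP] := comp_lip0_norm; exists (dual_norm phi * k) => g.
rewrite (le_trans (dual_normP _ _))// -mulrA ler_wpM2l//.
exact: best_constant_ge0.
Qed.

Definition pushforward (phi : dual (lip0 M)) : dual (lip0 N) :=
  MkDual (pushforward_dual phi).

Lemma pushforward_linear : linear pushforward.
Proof. by move=> c u v; exact/val_inj. Qed.

Lemma pushforward_norm :
  exists2 k : R, 0 <= k & forall phi, `|pushforward phi| <= k * `|phi|.
Proof.
have [k k0 kP] := comp_lip0_norm; exists k => // phi.
apply: dual_norm_le; first by rewrite mulr_ge0.
move=> g /=; rewrite (le_trans (dual_normP _ _))// (mulrC k) -mulrA.
by rewrite ler_wpM2l// best_constant_ge0.
Qed.

Lemma pushforward_eval x : pushforward (eval_lip0 x) = eval_lip0 (f x).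
Proof. exact/val_inj. Qed.

Lemma pushforward_lipfree (mu : lipfree M) : pushforward mu \in lipfree_pred N.
Proof.
have [k k0 kP] := pushforward_norm.
have /set_mem/closed_spanP muP := valP mu.
apply/mem_set/closed_spanP => e e0.
have k1 : 0 < k + 1 by rewrite ltr_wpDl.
have [w [n [c [v [vP ->]]]] wP] := muP (e / (k + 1)) ltac:(by rewrite divr_gt0).
pose L := GRing.isLinear.Build _ _ _ *:%R pushforward pushforward_linear.
pose P : {linear dual (lip0 M) -> dual (lip0 N)} := HB.pack pushforward L.
exists (P (\sum_(i < n) c i *: v i)).
  exists n, c, (P \o v); split.
    move=> i /=; have [x _ <-] := vP i; exists (f x) => //=.
    by rewrite pushforward_eval.
  by rewrite linear_sum; apply: eq_bigr => i _; rewrite linearZ.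
rewrite -[pushforward mu]/(P (val mu)) -linearB (le_lt_trans (kP _))//.
rewrite ltr_pdivlMr// in wP; apply: le_lt_trans wP.
by rewrite mulrC ler_wpM2l// lerDl.
Qed.

Definition lipfree_pushforward (mu : lipfree M) : lipfree N :=
  MkFree (pushforward_lipfree mu).

Lemma lipfree_pushforwardP : is_linearization f lipfree_pushforward.
Proof.
split.
- by move=> c u v; apply/val_inj; exact: pushforward_linear.
- by have [k _ kP] := pushforward_norm; exists k => mu; exact: kP.
- by move=> x; apply/val_inj; exact: pushforward_eval.
Qed.

End existence.

Lemma is_linearization_unique (f : M -> N) T S :
  is_linearization f T -> is_linearization f S -> T = S.
Proof.
move=> [Tl [k kP] Td] [Sl [l lP] Sd]; apply/funext => mu.
pose LT := GRing.isLinear.Build _ _ _ *:%R T Tl.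
pose LS := GRing.isLinear.Build _ _ _ *:%R S Sl.
pose T' : {linear lipfree M -> lipfree N} := HB.pack T LT.
pose S' : {linear lipfree M -> lipfree N} := HB.pack S LS.
apply/eqP; rewrite -subr_eq0 -normr_le0; apply/ler_addgt0Pr => e e0.
rewrite add0r; have /set_mem/closed_spanP muP := valP mu.
have kl0 : 0 < `|k| + `|l| + 1 by rewrite ltr_wpDl.
have [w [n [c [v [vP wE]]]] wP] :=
  muP (e / (`|k| + `|l| + 1)) ltac:(by rewrite divr_gt0).
have /choice[x xP] : forall i, exists x, v i = eval_lip0 x.
  by move=> i; have [x _ <-] := vP i; exists x.
pose nu : lipfree M := \sum_(i < n) c i *: delta (x i).
have nuE : val nu = w.
  by rewrite wE raddf_sum; apply: eq_bigr => i _; rewrite /= xP.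
have TS : T nu = S nu.
  rewrite -[T nu]/(T' nu) -[S nu]/(S' nu) !linear_sum.
  by apply: eq_bigr => i _; rewrite !linearZ /= Td Sd.
have -> : T mu - S mu = T (mu - nu) - S (mu - nu).
  have -> : T (mu - nu) = T mu - T nu by exact: (linearB T').
  have -> : S (mu - nu) = S mu - S nu by exact: (linearB S').
  by rewrite TS opprB addrA subrK.
have mn : `|mu - nu| < e / (`|k| + `|l| + 1) by rewrite -nuE in wP.
rewrite ltr_pdivlMr// in mn; apply: le_trans (ltW mn).
rewrite (le_trans (ler_normB _ _))//.
rewrite (le_trans (lerD (kP _) (lP _)))// -mulrDl mulrC ler_wpM2l//.
by rewrite -[leLHS]addr0 lerD// lerD// ler_norm.
Qed.

Lemma fhat_is_linearization (f : M -> N) :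
  Lip0 f -> is_linearization f (fhat f).
Proof.
by move=> f0; apply: (@xgetPex _ _ [set T | is_linearization f T]);
  exists (lipfree_pushforward f0); exact: lipfree_pushforwardP.
Qed.

Lemma fhat_unique (f : M -> N) T :
  Lip0 f -> is_linearization f T -> T = fhat f.
Proof.
by move=> /fhat_is_linearization f1 T1; exact: is_linearization_unique T1 f1.
Qed.

Lemma fhatE (f : M -> N) (f0 : Lip0 f) (mu : lipfree M) (g : lip0 N) :
  fhat f mu g = mu (comp_lip0 f0 g).
Proof. by rewrite -(fhat_unique f0 (lipfree_pushforwardP f0)). Qed.

Definition preserves_support (f : M -> N) (mu : lipfree M) :=
  supp (fhat f mu) = closure (f @` supp mu).

Definition preserves_supports (f : M -> N) :=
  forall mu : lipfree M, preserves_support f mu.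

End linearization.

(* Main.v *)
(* Call a set null for mu if mu kills the Lipschitz functions vanishing off it.
   Every point off the support S of mu has a null neighborhood, and this implies
   that mu kills every h vanishing on S: if a ball misses S but the concentric
   ball of a quarter of its radius were not null, the latter would contain
   non-null balls of arbitrarily small radius, hence, by completeness, these
   could be chosen to shrink to a point off S. Conversely, by Hahn-Banach, mu
   lies in F(K) as soon as it kills every h vanishing on K.
   If x is in supp(gamma) but f(x) is not in supp(fhat gamma), multiply gamma by
   the weight w = g o f, cut off away from the bounded set supp(gamma), where g
   is a bump at f(x) vanishing on supp(fhat gamma). The image of w gamma under
   fhat is g fhat(gamma) = 0, so w gamma = 0 by injectivity, although w gamma
   and gamma agree near x: a contradiction. *)
From HB Require Import structures.
Require Import Defs.
From mathcomp Require Import all_boot all_order all_algebra.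
From mathcomp Require Import all_classical all_reals all_analysis.
From mathcomp Require Import ring lra.

Set Implicit Arguments.
Unset Strict Implicit.
Unset Printing Implicit Defensive.

Import Order.TTheory GRing.Theory Num.Theory.
Import numFieldNormedType.Exports.

Local Open Scope classical_set_scope.
Local Open Scope ring_scope.

(** * Real-valued Lipschitz functions: lattice operations and cones *)

Section lipschitz_functions.
Context {R : realType} {M : pointedMetricType R}.
Implicit Types (k l : R) (f g : M -> R) (h : lip0 M).

(** Swapping [x] and [y] gives the two-sided bound; the one-sided form passes directly through
    maxima and minima. *)
Definition lipbound k f := forall x y, f x <= f y + k * mdist x y.

Lemma lipboundW k l f : k <= l -> lipbound k f -> lipbound l f.
Proof.
move=> kl fk x y; apply: (le_trans (fk x y)).
by rewrite lerD2l ler_wpM2r// mdist_ge0.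
Qed.

Lemma lipbound_cst k c : 0 <= k -> lipbound k (cst c).
Proof. by move=> k0 x y; rewrite lerDl mulr_ge0// mdist_ge0. Qed.

Lemma lipbound_max k f g : lipbound k f -> lipbound k g ->
  lipbound k (fun x => Num.max (f x) (g x)).
Proof.
move=> fk gk x y; rewrite addr_maxl ge_max !le_max.
by rewrite fk gk orbT.
Qed.

Lemma lipbound_min k f g : lipbound k f -> lipbound k g ->
  lipbound k (fun x => Num.min (f x) (g x)).
Proof.
move=> fk gk x y; rewrite addr_minl le_min !ge_min.
by rewrite fk gk orbT.
Qed.

Lemma lipbound_cone k a p : 0 <= k ->
  lipbound k (fun x => a - k * mdist p x).
Proof.
move=> k0 x y; rewrite -addrA lerD2l -lerBlDl opprK addrC -mulrBr.
rewrite ler_wpM2l// lerBlDr addrC (le_trans (metric_triangle _ x _))//.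
Qed.

Lemma lipbound_lip0 k f : 0 <= k -> lipbound k f -> f point = 0 ->
  exists2 h : lip0 M, forall x, h x = f x & `|h| <= k.
Proof.
move=> k0 fk fp.
have fk' x y : `|f x - f y| <= k * mdist x y.
  rewrite ler_norml; have := fk x y; have := fk y x.
  by rewrite (metric_sym y) => ? ?; apply/andP; split; lra.
have fP : (f : M -> R^o) \in lip0_pred M.
  apply/mem_set; split => //; exists k => x y.
  by rewrite /mdist/= distrC.
by exists (MkLip0 fP) => //; apply: lip_norm_le.
Qed.

Lemma lip0_lipbound h : lipbound `|h| h.
Proof.
by move=> x y; have := le_trans (ler_norm _) (lip_normP h x y); rewrite lerBlDl.
Qed.

Lemma lip0_bound h x : `|h x| <= `|h| * mdist x point.
Proof. by have := lip_normP h x point; rewrite lip0_point subr0. Qed.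

Lemma lip0_eqP h h' : (forall x, h x = h' x) <-> h = h'.
Proof. by split=> [H|->//]; apply/val_inj/funext. Qed.

Lemma lip0B h h' x : (h - h') x = h x - h' x. Proof. by []. Qed.

Lemma lip0_pos_neg h : exists u v : lip0 M,
  [/\ h = u - v, forall x, u x = Num.max (h x) 0
    & forall x, v x = Num.max (- h x) 0].
Proof.
have [u uE _] := @lipbound_lip0 `|h| (fun x => Num.max (h x) 0) (normr_ge0 _)
  (lipbound_max (lip0_lipbound h) (lipbound_cst _ (normr_ge0 _)))
  ltac:(by rewrite /= lip0_point maxxx).
have hN : lipbound `|h| (fun x => - h x : R).
  by move=> x y; have := lip0_lipbound h y x; rewrite metric_sym; lra.
have [v vE _] := @lipbound_lip0 `|h| (fun x => Num.max (- h x) 0) (normr_ge0 _)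
  (lipbound_max hN (lipbound_cst _ (normr_ge0 _)))
  ltac:(by rewrite /= lip0_point oppr0 maxxx).
exists u, v; split => //; apply/lip0_eqP => x; rewrite lip0B uE vE.
move: (h x : R) => a; change (a = Num.max a 0 - Num.max (- a) 0).
by case: (leP a 0); case: (leP (- a) 0); lra.
Qed.

(* McShane-type extension of [h] from the finite set [s], taken as small as
   possible. *)
Lemma lip0_cones h (s : seq M) L : `|h| <= L -> (forall x, 0 <= h x) ->
  exists k : lip0 M,
  [/\ `|k| <= L, forall y, 0 <= k y <= h y, forall x, x \in s -> k x = h x
    & forall y, (forall x, x \in s -> h x <= L * mdist x y) -> k y = 0].
Proof.
move=> hL h0; have L0 : 0 <= L by exact: le_trans hL.
elim: s => [|a s [k [kL kh ks k0]]].
  exists 0; split => //; first by rewrite normr0.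
  by move=> y; rewrite lexx h0.
have [||k' k'E k'L] := @lipbound_lip0 L
    (fun y => Num.max (k y) (h a - L * mdist a y)) L0.
- apply: lipbound_max; last exact: lipbound_cone.
  exact: lipboundW (lip0_lipbound k).
- rewrite lip0_point; apply/max_idPl.
  rewrite subr_le0 (le_trans (ler_norm _))// (le_trans (lip0_bound _ _))//.
  by rewrite ler_wpM2r// mdist_ge0.
have haL y : h a - L * mdist a y <= h y.
  by rewrite lerBlDr; exact: (lipboundW hL (lip0_lipbound h)).
exists k'; split => //.
- move=> y; rewrite k'E le_max ge_max haL andbT.
  by have /andP[-> ->] := kh y.
- move=> x; rewrite inE k'E => /predU1P[->|xs].
    rewrite mdistxx mulr0 subr0; apply/max_idPr.
    by have /andP[] := kh a.
  by rewrite (ks _ xs); apply/max_idPl.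
- move=> y H; rewrite k'E k0; last first.
    by move=> x xs; apply: H; rewrite inE xs orbT.
  by apply/max_idPl; rewrite subr_le0 H// mem_head.
Qed.

End lipschitz_functions.

(** * Elements of F(M) as functionals on Lipschitz functions *)

Section lipfree_functionals.
Context {R : realType} {M : pointedMetricType R}.
Implicit Types (mu : lipfree M) (h : lip0 M) (K : set M).

Lemma lipfreeB mu h h' : mu (h - h') = mu h - mu h'.
Proof. exact: linearB. Qed.

Lemma lipfree_eqP mu mu' : (forall h, mu h = mu' h) -> mu = mu'.
Proof. by move=> H; do 2 apply/val_inj; apply/funext. Qed.

Lemma lipfree_sumE n (c : 'I_n -> R) (x : 'I_n -> M) h :
  (\sum_(i < n) c i *: delta (x i) : lipfree M) h = \sum_(i < n) c i * h (x i).
Proof.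
elim/big_ind2 : _ => // [a b u v <- <- //].
Qed.

Lemma lipfree_onP K mu : lipfree_on K mu <-> forall e : R, 0 < e ->
  exists n (c : 'I_n -> R) (x : 'I_n -> M), (forall i, K (x i)) /\
    `|mu - \sum_(i < n) c i *: delta (x i)| < e.
Proof.
split=> [/closed_spanP muK e /muK[_ [n [c [w [Kw ->]]]] me]|H].
  have /choice[x xP] : forall i, exists x, K x /\ w i = delta x.
    by move=> i; have [x ? <-] := Kw i; exists x.
  exists n, c, x; split => [i|]; first by have [] := xP i.
  by under eq_bigr do rewrite -(xP _).2.
apply/closed_spanP => e /H[n [c [x [Kx me]]]].
exists (\sum_(i < n) c i *: delta (x i)) => //.
exists n, c, (fun i => delta (x i)).
by split => // i; exists (x i).
Qed.

Lemma lipfree_onT mu : lipfree_on setT mu.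
Proof.
apply/lipfree_onP => e e0; have /set_mem/closed_spanP muP := valP mu.
have [_ [n [c [w [Kw ->]]]] me] := muP e e0.
have /choice[x xP] : forall i, exists x, w i = eval_lip0 x.
  by move=> i; have [x ? <-] := Kw i; exists x.
pose nu : lipfree M := \sum_(i < n) c i *: delta (x i).
have nuE : val nu = \sum_(i < n) c i *: w i.
  by rewrite raddf_sum; apply: eq_bigr => i _; rewrite xP.
by exists n, c, x; split => //; rewrite -nuE in me.
Qed.

(** [s] lists the atoms of a finite combination of evaluations within [e] of [mu]; this combination
    kills every [h] vanishing on [s]. *)
Lemma lipfree_on_seq K mu e : lipfree_on K mu -> 0 < e ->
  exists2 s : seq M, (forall x, x \in s -> K x) &
    forall h, (forall x, x \in s -> h x = 0) -> `|mu h| <= e * `|h|.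
Proof.
move=> /lipfree_onP/[apply] -[n [c [x [Kx me]]]].
exists [seq x i | i <- enum 'I_n]; first by move=> _ /mapP[i _ ->].
move=> h hx; have -> : mu h = (mu - \sum_(i < n) c i *: delta (x i)) h.
  transitivity (mu h - (\sum_(i < n) c i *: delta (x i) : lipfree M) h) => //.
  rewrite lipfree_sumE big1 ?subr0// => i _.
  by rewrite hx ?mulr0// map_f// mem_enum.
apply: (le_trans (dual_normP _ _)); rewrite ler_wpM2r//; exact: ltW.
Qed.

Lemma lipfree_on_eq0 K mu h : lipfree_on K mu ->
  (forall x, K x -> h x = 0) -> mu h = 0.
Proof.
move=> muK hK; apply/eqP; rewrite -normr_le0; apply/ler_addgt0Pr => e e0.
have h1 : 0 < `|h| + 1 by rewrite ltr_wpDl.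
have [s sK sP] := lipfree_on_seq muK (divr_gt0 e0 h1).
rewrite add0r (le_trans (sP _ _))//; first by move=> x /sK /hK.
by rewrite mulrAC ler_pdivrMr// ler_wpM2l ?ltW// ltrDl.
Qed.

(** The positive and negative parts of [h] vanish wherever [h] does. *)
Lemma lipfree_eq0_pos mu K :
  (forall h, (forall x, 0 <= h x) -> (forall x, K x -> h x = 0) -> mu h = 0) ->
  forall h, (forall x, K x -> h x = 0) -> mu h = 0.
Proof.
move=> pos h hK; have [u [v [huv uE vE]]] := lip0_pos_neg h.
rewrite huv lipfreeB !pos ?subr0// => x.
- by rewrite vE le_max lexx orbT.
- by move=> /hK; rewrite vE => ->; rewrite oppr0 maxxx.
- by rewrite uE le_max lexx orbT.
- by move=> /hK; rewrite uE => ->; rewrite maxxx.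
Qed.

End lipfree_functionals.

(** * Null sets of an element of F(M) *)

Section null_sets.
Context {R : realType} {M : pointedMetricType R}.
Implicit Types (mu : lipfree M) (h : lip0 M) (A B : set M).

(** Nonnegative test functions can be cut down by minima with cones; [lipfree_eq0_pos] recovers the
    others. *)
Definition null mu A := forall h, (forall x, 0 <= h x) ->
  (forall x, ~ A x -> h x = 0) -> mu h = 0.

Lemma nullS mu A B : A `<=` B -> null mu B -> null mu A.
Proof. by move=> AB nB h h0 hA; apply: nB => // x Bx; apply: hA => /AB. Qed.

Lemma null_ball_le mu x (r s : R) :
  r <= s -> null mu (ball x s) -> null mu (ball x r).
Proof. by move=> rs; apply: nullS; exact: le_ball. Qed.

(** Induction on [s]: [k] is the minimum of [h] and a cone living on the ball of radius [2 * r a],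
    so [mu] kills it; [h - k] vanishes within [r a] of [a] and is left to the remaining balls. *)
Lemma null_finite_cover mu (r : M -> R) (s : seq M) :
  (forall x, x \in s -> 0 < r x /\ null mu (ball x (2 * r x))) ->
  null mu [set y | exists2 x, x \in s & mdist x y < r x].
Proof.
elim: s => [|a s IH] sr h h0 hs.
  have -> : h = 0 by apply/lip0_eqP => x; rewrite hs// => -[].
  by rewrite linear0.
have [ra na] := sr _ (mem_head a s).
(* Within [r a] of [a] the cone is at least [L * r a], which the second term makes an upper bound
   for [h] there. *)
pose L := Num.max `|h| ((h a + `|h| * r a) / r a).
have hL : `|h| <= L by rewrite le_max lexx.
have L0 : 0 <= L by exact: le_trans hL.
have [||k kE _] := @lipbound_lip0 R M L
    (fun y => Num.min (h y) (Num.max 0 (L * (2 * r a) - L * mdist a y))) L0.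
- apply: lipbound_min; first exact: lipboundW hL (lip0_lipbound h).
  by apply: lipbound_max; [exact: lipbound_cst|exact: lipbound_cone].
- by rewrite lip0_point; apply/min_idPl; rewrite le_max lexx.
have k0 y : 0 <= k y by rewrite kE le_min h0 le_max lexx.
have mk : mu k = 0.
  apply: na => // y; rewrite ballEmdist/= => /negP; rewrite -leNgt => ray.
  rewrite kE; have -> : Num.max 0 (L * (2 * r a) - L * mdist a y) = 0.
    by apply/max_idPl; rewrite subr_le0 ler_wpM2l.
  exact/min_idPr.
have mhk : mu (h - k) = 0.
  apply: IH => [x xs|x|y ys]; first by apply: sr; rewrite inE xs orbT.
    by rewrite lip0B subr_ge0 kE ge_min lexx.
  rewrite lip0B kE; have [ay|ay] := ltP (mdist a y) (r a); last first.
    rewrite hs/= ?(min_idPl _) ?subrr ?le_max ?lexx//.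
    move=> [x]; rewrite inE => /predU1P[->|xs] xy.
      by rewrite ltNge ay in xy.
    by apply: ys; exists x.
  rewrite (min_idPl _) ?subrr// le_max; apply/orP; right.
  have hy : h y <= h a + `|h| * r a.
    rewrite (le_trans (lip0_lipbound h y a))// lerD2l ler_wpM2l//.
    by rewrite metric_sym ltW.
  apply: (le_trans hy); rewrite -mulrBr.
  have Lr : h a + `|h| * r a <= L * r a.
    by rewrite -ler_pdivrMr// le_max lexx orbT.
  by apply: (le_trans Lr); rewrite ler_wpM2l//; lra.
by rewrite -[h](subrK k) linearD /= mk mhk addr0.
Qed.

(* The function [h] is replaced by the maximum of finitely many cones below it,
   which agrees with [h] on the support of a finitely supported approximation of [mu]
   while being as Lipschitz as [h] up to a constant. *)
Lemma null_local mu h (C : R) : 0 < C -> (forall x, 0 <= h x) ->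
  (forall x, 0 < h x -> null mu (ball x (h x / C))) -> mu h = 0.
Proof.
(* As [2 * C <= L], twice the radius [h x / L] is at most [h x / C], the radius of a null ball. *)
move=> C0 h0 hn; pose L := Num.max (2 * C) `|h|.
have hL : `|h| <= L by rewrite le_max lexx orbT.
have CL : 2 * C <= L by rewrite le_max lexx.
have L0 : 0 < L by apply: lt_le_trans CL; rewrite mulr_gt0.
apply/eqP; rewrite -normr_le0; apply/ler_addgt0Pr => e e0; rewrite add0r.
(* Both [h] and [k] will have norm at most [L], so this tolerance bounds the value of [mu] at
   [h - k] by [e]. *)
have [s _ sP] := lipfree_on_seq (@lipfree_onT _ _ mu)
  (divr_gt0 e0 (mulr_gt0 (ltr0n R 2) L0)).
have [k [kL kh ks k0]] := lip0_cones s hL h0.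
have mk : mu k = 0.
  apply: (@null_finite_cover mu (fun x => h x / L) [seq x <- s | 0 < h x]).
  - move=> x; rewrite mem_filter => /andP[hx xs]; split; first exact: divr_gt0.
    apply: null_ball_le (hn _ hx).
    by rewrite mulrCA ler_wpM2l// ler_pdivrMr// ler_pdivlMl// mulrC.
  - by move=> x; have /andP[] := kh x.
  - move=> y ys; apply: k0 => x xs; rewrite leNgt; apply/negP => xy; apply: ys.
    have hx : 0 < h x.
      by apply: le_lt_trans xy; rewrite mulr_ge0 ?mdist_ge0// ltW.
    by exists x; [rewrite mem_filter hx|rewrite ltr_pdivlMr// mulrC].
have -> : mu h = mu (h - k) by rewrite lipfreeB mk subr0.
rewrite (le_trans (sP _ _))//.
  by move=> x /ks; rewrite lip0B => ->; rewrite subrr.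
rewrite mulrAC ler_pdivrMr ?mulr_gt0// (ler_wpM2l (ltW e0))//.
by rewrite (le_trans (ler_normB _ _))// mulr_natl mulr2n lerD.
Qed.

(** On the ball [h] is at most [b], so with the constant [(b + 1) / c] the radii in [null_local] do
    not exceed [c]. *)
Lemma null_ball_uniform mu p (r c : R) : 0 < c ->
  (forall x, ball p r x -> null mu (ball x c)) -> null mu (ball p r).
Proof.
move=> c0 pc h h0 hp; pose b := `|h| * (`|r| + mdist p point).
have b0 : 0 <= b by rewrite mulr_ge0// addr_ge0// mdist_ge0.
have C0 : 0 < (b + 1) / c by rewrite divr_gt0// ltr_wpDl.
apply: (null_local C0) => // x hx.
have px : ball p r x.
  by apply: contrapT => /hp hx0; rewrite hx0 ltxx in hx.
apply: null_ball_le (pc _ px); rewrite ler_pdivrMr// mulrCA divff ?gt_eqF//.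
rewrite mulr1 (le_trans (ler_norm _))// (le_trans (lip0_bound _ _))//.
rewrite ler_wpDr// ler_wpM2l// (le_trans (metric_triangle _ p _))// lerD2r.
move: px; rewrite ballEmdist/= metric_sym => /ltW/le_trans; apply.
exact: ler_norm.
Qed.

End null_sets.

(** * Geometric convergence in complete spaces *)

Lemma divr_exp2_lt (R : archiRealFieldType) (r e : R) :
  0 < e -> exists n, r / 2 ^+ n < e.
Proof.
move=> e0; exists (Num.bound `|r / e|).
rewrite ltr_pdivrMr ?exprn_gt0// mulrC -ltr_pdivrMr//.
rewrite (le_lt_trans (ler_norm _))// (lt_le_trans (archi_boundP _))//.
by rewrite -natrX ler_nat; exact/ltnW/ltn_expl.
Qed.

Lemma geometric_cvg (R : realType) (M : completePointedMetricType R)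
    (u : nat -> M) (r : R) :
  (forall n, mdist (u n) (u n.+1) <= r / 2 ^+ n.+1) ->
  exists l : M, forall n, mdist (u n) l <= r / 2 ^+ n.
Proof.
move=> ur.
have r0 : 0 <= r.
  by have := le_trans (mdist_ge0 _ _) (ur 0%N); rewrite pmulr_lge0// invr_gt0.
(* The subtracted term makes the induction telescope. *)
have tail n k : mdist (u n) (u (n + k)%N) <= r / 2 ^+ n - r / 2 ^+ (n + k).
  elim: k => [|k IH]; first by rewrite addn0 mdistxx subrr.
  rewrite (le_trans (metric_triangle _ (u (n + k)%N) _))// addnS.
  have := ur (n + k)%N; rewrite exprS invfM mulrA => uk.
  have : r / 2 * (2 ^+ (n + k))^-1 = (r / 2 ^+ (n + k)) / 2 by rewrite mulrAC.
  by move: IH uk; lra.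
have tail' n k : mdist (u n) (u (n + k)%N) <= r / 2 ^+ n.
  by apply: le_trans (tail n k) _; rewrite gerBl divr_ge0// exprn_ge0.
have cu : cauchy (u @ \oo).
  apply/cauchy_exP => e e0; have [n ne] := divr_exp2_lt r e0.
  exists (u n); exists n => // m /= nm; rewrite ballEmdist/=.
  by rewrite -(subnKC nm) (le_lt_trans (tail' _ _)).
have /cauchy_cvg/cvg_ex[l ul] := cu.
exists l => n; apply/ler_addgt0Pr => e e0.
have [m _ me] := (metricType_numDomainType.cvgrPdist_lt u l).1 ul e e0.
have := me (n + m)%N (leq_addl _ _) => /= lm.
rewrite (le_trans (metric_triangle _ (u (n + m)%N) _))//.
by rewrite lerD// 1?metric_sym ltW.
Qed.

(** * Functions vanishing on the support *)

Section support.
Context {R : realType} {M : completePointedMetricType R}.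
Implicit Types (mu : lipfree M) (h : lip0 M).

(* Otherwise [null_ball_uniform] yields non-null balls of radii shrinking to
   zero whose centers converge to a point of [ball p r]. *)
Lemma null_ball_complete mu p (r : R) : 0 < r ->
  (forall x, ball p r x -> exists2 s : R, 0 < s & null mu (ball x s)) ->
  null mu (ball p (r / 4)).
Proof.
move=> r0 loc; apply: contrapT => np.
pose rad n : R := r / 4 / 2 ^+ n.
have rad0 n : 0 < rad n by rewrite !divr_gt0// exprn_gt0.
(* By [null_ball_uniform], a non-null ball contains a point whose ball of half the radius is not
   null either. *)
have /choice[g gP] : forall nx : nat * M, exists y,
    ~ null mu (ball nx.2 (rad nx.1)) ->
    ball nx.2 (rad nx.1) y /\ ~ null mu (ball y (rad nx.1.+1)).
  move=> [n x] /=; have [nx|nx] := pselect (null mu (ball x (rad n))).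
    by exists x.
  have /existsNP[y /not_implyP[xy ny]] :
      ~ forall y, ball x (rad n) y -> null mu (ball y (rad n.+1)).
    by move=> /(null_ball_uniform (rad0 n.+1)).
  by exists y.
pose u := fix u n := if n is m.+1 then g (m, u m) else p.
have uP n : ~ null mu (ball (u n) (rad n)).
  elim: n => [|n IH]; first by rewrite /rad expr0 divr1.
  by have [] := gP (n, u n) IH.
have du n : mdist (u n) (u n.+1) <= (r / 2) / 2 ^+ n.+1.
  have [+ _] := gP (n, u n) (uP n).
  rewrite ballEmdist/= => /ltW/le_trans; apply.
  rewrite /rad exprS invfM mulrA; lra.
have [l ul] := geometric_cvg du.
have [|s s0 ls] := loc l.
  rewrite ballEmdist/=; have := ul 0%N; rewrite expr0 divr1 /=; lra.
(* Since [r / 2 + r / 4 < r], the ball about [u n] lies in [ball l s] once [r / 2 ^+ n < s]. *)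
have [n ns] := divr_exp2_lt r s0; apply: (uP n); apply: nullS ls => y.
have := ul n; rewrite !ballEmdist/= /rad => uln uny.
rewrite (le_lt_trans (metric_triangle _ (u n) _))// metric_sym.
have : 0 < r / 2 ^+ n by rewrite divr_gt0// exprn_gt0.
have E c : r / c / 2 ^+ n = r / 2 ^+ n / c by rewrite mulrAC.
by move: uln uny ns; rewrite !E; lra.
Qed.

Lemma supp_closed mu : closed (supp mu).
Proof. by apply: closed_bigI => K []. Qed.

Lemma notin_supp mu x : ~ supp mu x -> exists K : set M,
  lipfree_on (K `|` [set point]) mu /\
  exists2 s : R, 0 < s & ball x s `<=` ~` K.
Proof.
move=> /existsNP[K /not_implyP[[Kc Kmu] Kx]]; exists K; split => //.
by apply/nbhs_ballP/open_nbhs_nbhs; split; first exact: closed_openC.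
Qed.

(** For [h >= 0] and [h x > 0], the ball about [x] of radius [h x] over the norm of [h] plus 1
    misses the support. By [null_ball_complete] its quarter is null, as [null_local] requires. *)
Lemma supp_null mu h : (forall x, supp mu x -> h x = 0) -> mu h = 0.
Proof.
move: h; apply: lipfree_eq0_pos => h h0 hs.
have h1 : 0 < `|h| + 1 by rewrite ltr_wpDl.
apply: (@null_local _ _ _ _ ((`|h| + 1) * 4)) => [|//|x hx].
  by rewrite mulr_gt0.
rewrite invfM mulrA; apply: null_ball_complete => [|y].
  by rewrite divr_gt0.
rewrite ballEmdist/= ltr_pdivlMr// => xy.
have /notin_supp[K [Kmu [s s0 sK]]] : ~ supp mu y.
  move=> /hs hy; have := lip0_lipbound h x y; rewrite hy.
  by have := mdist_ge0 x y; move: xy; lra.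
exists s => // k _ kK.
apply: (lipfree_on_eq0 Kmu) => z [Kz|->]; last exact: lip0_point.
by apply: kK => /sK.
Qed.

End support.

(** * The Hahn-Banach theorem for sublinear functionals *)

Section hahn_banach.
Context {R : realType} {V : lmodType R}.
Implicit Types (p q : V -> R) (x y v : V).

Definition sublinear q := (forall x y, q (x + y) <= q x + q y) /\
  (forall t x, 0 <= t -> q (t *: x) = t * q x).

Lemma sublinear_suff q : (forall x y, q (x + y) <= q x + q y) -> q 0 = 0 ->
  (forall t x, 0 < t -> q (t *: x) <= t * q x) -> sublinear q.
Proof.
move=> qD q0 qZ; split => // t x; rewrite le_eqVlt => /predU1P[<-|t0].
  by rewrite scale0r mul0r.
apply/eqP; rewrite eq_le qZ//= -ler_pdivlMl//.
have := qZ t^-1 (t *: x); rewrite scalerA mulVf ?gt_eqF// scale1r; apply.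
by rewrite invr_gt0.
Qed.

Lemma sublinear0 q : sublinear q -> q 0 = 0.
Proof. by move=> [_ qZ]; rewrite -(scale0r 0) qZ// mul0r. Qed.

Lemma sublinearN_ge q x : sublinear q -> - q (- x) <= q x.
Proof.
by move=> qs; rewrite -subr_ge0 opprK -(sublinear0 qs) -(subrr x) qs.1.
Qed.

(** For sublinear [q], a sublinear functional below [q] whose value at [- v] is at most [- q v]: it
    pushes [q] towards linearity along [v]. *)
Definition slide q v x : R :=
  inf [set q (x + t *: v) - t * q v | t in [set t | 0 <= t]].

Lemma slide_le q v x t : sublinear q -> 0 <= t ->
  slide q v x <= q (x + t *: v) - t * q v.
Proof.
move=> qs t0; apply: ge_inf; last by exists t.
(* This lower bound keeps the infimum from being a default value. *)
exists (- q (- x)) => _ [s s0 <-]; rewrite lerBrDr addrC lerBlDr.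
by rewrite -qs.2// (le_trans _ (qs.1 _ _))// addrAC subrr add0r.
Qed.

Lemma le_slide q v x a :
  (forall t, 0 <= t -> a <= q (x + t *: v) - t * q v) -> a <= slide q v x.
Proof.
move=> H; apply: lb_le_inf; last by move=> _ [t t0 <-]; exact: H.
by exists (q (x + 0 *: v) - 0 * q v), 0 => /=.
Qed.

Lemma slide_sublinear q v : sublinear q -> sublinear (slide q v).
Proof.
move=> qs; apply: sublinear_suff => [x y||t x t0].
- rewrite -lerBlDr; apply: le_slide => t t0; rewrite lerBlDr -lerBlDl.
  apply: le_slide => s s0; rewrite lerBlDl.
  apply: (le_trans (slide_le v _ qs (addr_ge0 t0 s0))).
  rewrite scalerDl mulrDl opprD addrACA [leRHS]addrACA lerD2r.
  exact: qs.1.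
- apply/eqP; rewrite eq_le; apply/andP; split.
    rewrite (le_trans (slide_le v 0 qs (lexx 0)))//.
    by rewrite scale0r mul0r addr0 subr0 sublinear0.
  by apply: le_slide => t t0; rewrite add0r qs.2// subrr.
- rewrite -ler_pdivrMl//; apply: le_slide => s s0; rewrite ler_pdivrMl//.
  apply: (le_trans (slide_le v _ qs (mulr_ge0 (ltW t0) s0))).
  by rewrite -scalerA -scalerDr qs.2 ?(ltW t0)// mulrBr mulrA.
Qed.

(** Zorn's lemma for the reversed pointwise order. The infimum of a chain is finite because each
    member is at least [- q0 (- x)] at [x]. *)
Lemma sublinear_minimal q0 : sublinear q0 -> exists q,
  [/\ sublinear q, forall x, q x <= q0 x &
    forall q', sublinear q' -> (forall x, q' x <= q x) -> q' = q].
Proof.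
move=> q0s.
pose T := {q : V -> R | sublinear q /\ forall x, q x <= q0 x}.
pose t0 : T := exist _ q0 (conj q0s (fun x => lexx _)).
pose below (s t : T) := `[< forall x, sval t x <= sval s x >].
have [||||t tmin] := @Zorn T below.
- by move=> t; apply/asboolP.
- move=> r s t /asboolP rs /asboolP st; apply/asboolP => x.
  exact: le_trans (st x) (rs x).
- move=> [s sP] [t tP] /asboolP /= st /asboolP /= ts; apply: eq_exist.
  by apply/funext => x; apply/le_anti; rewrite st ts.
- move=> A Atot; have [->|/set0P[a Aa]] := eqVneq A set0; first by exists t0.
  pose Q x : R := inf [set sval t x | t in A].
  have Q_le t x : A t -> Q x <= sval t x.
    move=> At; apply: ge_inf; last by exists t.
    exists (- q0 (- x)) => _ [s As <-].
    by rewrite (le_trans _ (sublinearN_ge x (svalP s).1))// lerN2 (svalP s).2.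
  have le_Q b x : (forall t, A t -> b <= sval t x) -> b <= Q x.
    move=> H; apply: lb_le_inf; last by move=> _ [t At <-]; exact: H.
    by exists (sval a x), a.
  have Qs : sublinear Q.
    apply: sublinear_suff => [x y||c x c0].
    - rewrite -lerBlDr; apply: (le_Q) => s As; rewrite lerBlDr -lerBlDl.
      apply: (le_Q) => t At; rewrite lerBlDl.
      (* The smaller of the two chain members serves for both [x] and [y]. *)
      have [/asboolP st|/asboolP ts] := Atot s t As At.
        rewrite (le_trans (Q_le _ _ At))// (le_trans ((svalP t).1.1 _ _))//.
        by rewrite lerD2r.
      rewrite (le_trans (Q_le _ _ As))// (le_trans ((svalP s).1.1 _ _))//.
      by rewrite lerD2l.
    - apply/eqP; rewrite eq_le; apply/andP; split.
        by rewrite (le_trans (Q_le _ _ Aa))// (sublinear0 (svalP a).1).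
      by apply: (le_Q) => t _; rewrite (sublinear0 (svalP t).1).
    - rewrite -ler_pdivrMl//; apply: (le_Q) => s As; rewrite ler_pdivrMl//.
      by rewrite -((svalP s).1.2 _ _ (ltW c0)) Q_le.
  have Q0 x : Q x <= q0 x by rewrite (le_trans (Q_le _ _ Aa))// (svalP a).2.
  exists (exist _ Q (conj Qs Q0)) => s As; apply/asboolP => x /=; exact: Q_le.
- exists (sval t); split; [exact: (svalP t).1|exact: (svalP t).2|].
  move=> q' q's q't.
  have q'0 x : q' x <= q0 x by rewrite (le_trans (q't x))// (svalP t).2.
  by rewrite -(tmin (exist _ q' (conj q's q'0)))//; apply/asboolP.
Qed.

(* A minimal sublinear functional [q] equals [slide q y] for every [y], which
   forces it to be additive. *)
Lemma hahn_banach p v : sublinear p -> exists phi : {linear V -> R^o},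
  (forall x, phi x <= p x) /\ phi v = p v.
Proof.
(* Starting below [slide p v] gives [q (- v) <= - p v], which yields [q v = p v] at the end. *)
move=> ps; have [q [qs qp qmin]] := sublinear_minimal (slide_sublinear v ps).
have qD x y : q (x + y) = q x + q y.
  apply/eqP; rewrite eq_le qs.1/= -lerBrDr.
  rewrite -{1}(qmin _ (slide_sublinear y qs)).
    by rewrite (le_trans (slide_le y x qs ler01))// scale1r mul1r.
  move=> z; rewrite (le_trans (slide_le y z qs (lexx 0)))//.
  by rewrite scale0r mul0r addr0 subr0.
have qN x : q (- x) = - q x.
  by apply/eqP; rewrite -addr_eq0 -qD addNr (sublinear0 qs).
have qZ c x : q (c *: x) = c * q x.
  have [c0|c0] := leP 0 c; first exact: qs.2.
  by rewrite -[c]opprK scaleNr qN qs.2 ?mulNr// oppr_ge0 ltW.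
have ql : linear (q : V -> R^o) by move=> c x y; rewrite qD qZ.
pose L := GRing.isLinear.Build _ _ _ *:%R (q : V -> R^o) ql.
pose phi : {linear V -> R^o} := HB.pack (q : V -> R^o) L.
have pslide x t : 0 <= t -> q x <= p (x + t *: v) - t * p v.
  by move=> t0; rewrite (le_trans (qp x))// slide_le.
have qp' x : q x <= p x.
  by have := pslide x 0 (lexx 0); rewrite scale0r mul0r addr0 subr0.
exists phi; split => //; apply/eqP; rewrite eq_le qp'/=.
have := pslide (- v) 1 ler01; rewrite scale1r mul1r addNr (sublinear0 ps).
by rewrite qN add0r lerN2.
Qed.

End hahn_banach.

(** * Duality and the subspaces F(K) *)

Section annihilator.
Context {R : realType} {M : pointedMetricType R}.
Implicit Types (mu : lipfree M) (h : lip0 M).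

Lemma deltaE (x : M) h : delta x h = h x. Proof. by []. Qed.

Lemma delta_dist (x y : M) : `|delta x - delta y| <= mdist x y.
Proof.
apply: dual_norm_le; first exact: mdist_ge0.
by move=> h; rewrite mulrC; exact: lip_normP.
Qed.

Lemma delta_point : delta point = 0 :> lipfree M.
Proof. by apply/lipfree_eqP => h; rewrite deltaE lip0_point. Qed.

(** Take [h x = phi (delta x)]: [phi] and evaluation at [h] are bounded and agree on the dense span
    of the [delta x]. *)
Lemma bounded_linear_lip0 (phi : {linear lipfree M -> R^o}) :
  (forall mu, phi mu <= `|mu|) ->
  exists h, forall mu, phi mu = mu h.
Proof.
move=> phi1.
have phiN mu : `|phi mu| <= `|mu|.
  rewrite ler_norml phi1 andbT lerNl -(linearN phi).
  by rewrite (le_trans (phi1 _))// normrN.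
have [||h hE h1] := @lipbound_lip0 R M 1 (fun x => phi (delta x)) ler01.
- move=> x y; rewrite -lerBlDl mul1r -(linearB phi).
  by rewrite (le_trans (phi1 _))// delta_dist.
- by rewrite delta_point linear0.
exists h => mu; apply/eqP; rewrite -subr_eq0 -normr_le0.
apply/ler_addgt0Pr => e e0; rewrite add0r.
have [n [c [x [_ me]]]] :=
  (lipfree_onP _ _).1 (@lipfree_onT _ _ mu) _ (divr_gt0 e0 (ltr0n R 2)).
set nu : lipfree M := \sum_(i < n) c i *: delta (x i) in me.
have nuE : phi nu = nu h.
  rewrite lipfree_sumE linear_sum; apply: eq_bigr => i _.
  by rewrite linearZ hE.
have -> : phi mu - mu h = phi (mu - nu) - (mu - nu) h.
  have -> : (mu - nu) h = mu h - nu h by [].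
  by rewrite (linearB phi) nuE opprB addrA subrK.
rewrite (le_trans (ler_normB _ _))// [leRHS](splitr e) lerD//.
  by rewrite (le_trans (phiN _))// ltW.
rewrite (le_trans (dual_normP _ _))// (le_trans _ (ltW me))//.
exact: (ler_piMr (normr_ge0 (mu - nu)) h1).
Qed.

(** If [mu] were at distance at least [e] from the span, Hahn-Banach for the distance [p] would give
    [phi <= p] with [phi mu >= e]. As [p] vanishes on the span, [phi] is evaluation at some [h]
    vanishing on [K], so [phi mu = 0]. *)
Lemma annihilator_lipfree_on K mu :
  (forall h, (forall x, K x -> h x = 0) -> mu h = 0) ->
  lipfree_on (K `|` [set point]) mu.
Proof.
move=> muK; apply/closed_spanP => e e0; apply: contrapT => far.
pose W := lin_span ((@delta R M) @` (K `|` [set point])).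
pose p (v : lipfree M) : R := inf [set `|v - w| | w in W].
have W0 : W 0 by exact: lin_span0.
have p_le v w : W w -> p v <= `|v - w|.
  by move=> Ww; apply: ge_inf; [exists 0 => _ [u _ <-]|exists w].
have le_p v b : (forall w, W w -> b <= `|v - w|) -> b <= p v.
  move=> H; apply: lb_le_inf; last by move=> _ [w Ww <-]; exact: H.
  by exists `|v - 0|, 0.
have ps : sublinear p.
  apply: sublinear_suff => [x y||t x t0].
  - rewrite -lerBlDr; apply: (le_p) => u Wu; rewrite lerBlDr -lerBlDl.
    apply: (le_p) => w Ww; rewrite lerBlDl.
    have := lin_span_comb 1 Wu Ww; rewrite scale1r => /(p_le (x + y))/le_trans.
    by apply; rewrite opprD addrACA ler_normD.
  - apply/eqP; rewrite eq_le; apply/andP; split; last exact: le_p.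
    by rewrite (le_trans (p_le _ _ W0))// subr0 normr0.
  - rewrite -ler_pdivrMl//; apply: (le_p) => w Ww; rewrite ler_pdivrMl//.
    have := lin_span_comb t Ww W0; rewrite addr0 => /(p_le (t *: x))/le_trans.
    by apply; rewrite -scalerBr normrZ gtr0_norm.
have [phi [phip phimu]] := hahn_banach mu ps.
have [|h hE] := @bounded_linear_lip0 phi.
  by move=> v; rewrite (le_trans (phip v))// (le_trans (p_le _ _ W0))// subr0.
have hK x : K x -> h x = 0.
  move=> Kx; have Wx : W (delta x) by apply: lin_span_sub; exists x => //; left.
  rewrite -deltaE -hE; apply/eqP; rewrite eq_le; apply/andP; split.
    by rewrite (le_trans (phip _))// (le_trans (p_le _ _ Wx))// subrr normr0.
  rewrite -oppr_le0 -(linearN phi) (le_trans (phip _))//.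
  have := lin_span_comb (-1) Wx W0; rewrite addr0 scaleN1r.
  by move=> /p_le/le_trans; apply; rewrite subrr normr0.
have : e <= p mu.
  apply: (le_p) => w Ww; rewrite leNgt; apply/negP => mw; apply: far.
  by exists w.
by rewrite -phimu hE muK// leNgt e0.
Qed.

End annihilator.

(** * Multiplication by weights with bounded support *)

Section weights.
Context {R : realType} {M : pointedMetricType R}.
Implicit Types (a l r : R) (p x : M) (w : M -> R) (h : lip0 M).

Definition bump a l p x : R := Num.max 0 (Num.min 1 (a - l * mdist p x)).

Lemma bump_lipbound a l p : 0 <= l -> lipbound l (bump a l p).
Proof.
move=> l0; apply: lipbound_max; first exact: lipbound_cst.
by apply: lipbound_min; [exact: lipbound_cst|exact: lipbound_cone].
Qed.

Lemma bump_ge0 a l p x : 0 <= bump a l p x.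
Proof. by rewrite le_max lexx. Qed.

Lemma bump_le1 a l p x : bump a l p x <= 1.
Proof. by rewrite ge_max ler01 ge_min lexx. Qed.

Lemma bump1 a l p x : l * mdist p x <= a - 1 -> bump a l p x = 1.
Proof.
by move=> H; rewrite /bump (min_idPl _) ?(max_idPr _)//; move: H; lra.
Qed.

Lemma bump0 a l p x : a <= l * mdist p x -> bump a l p x = 0.
Proof.
by move=> H; apply/max_idPl; rewrite ge_min; apply/orP; right; rewrite subr_le0.
Qed.

Record weight l r w : Prop := Weight {
  weight_lip : lipbound l w;
  weight_ge0 : forall x, 0 <= w x;
  weight_le1 : forall x, w x <= 1;
  weight_out : forall x, r <= mdist x point -> w x = 0 }.

(** On the ball of radius [r] about the base point [h] is at most [r] times its norm, so the product
    rule gives the factor [l * r + 1]. *)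
Lemma weight_mul l r w h : 0 <= l -> 0 <= r -> weight l r w ->
  exists2 k : lip0 M, forall x, k x = w x * h x & `|k| <= (l * r + 1) * `|h|.
Proof.
move=> l0 r0 [wl w0 w1 wr].
have step x y : mdist x point <= r ->
    `|w x * h x - w y * h y| <= (l * r + 1) * `|h| * mdist x y.
  move=> xr; have hx : `|h x : R| <= `|h| * r.
    by rewrite (le_trans (lip0_bound _ _))// ler_wpM2l.
  have hxy : `|(h x : R) - h y| <= `|h| * mdist x y by exact: lip_normP.
  have wxy : `|w x - w y| <= l * mdist x y.
    by rewrite ler_norml lerBlDl wl andbT lerNl opprB lerBlDl metric_sym wl.
  move: (h x : R) (h y : R) (`|h| : R) (mdist x y : R) hx hxy wxy.
  move=> a b H d ha hab wxy.
  have -> : w x * a - w y * b = (w x - w y) * a + w y * (a - b) by ring.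
  have -> : (l * r + 1) * H * d = l * d * (H * r) + 1 * (H * d) by ring.
  rewrite (le_trans (ler_normD _ _))// !normrM (ger0_norm (w0 y)).
  by rewrite lerD// ler_pM.
have [|||k kE kl] :=
  @lipbound_lip0 R M ((l * r + 1) * `|h|) (fun x => w x * h x).
- by rewrite mulr_ge0// addr_ge0// mulr_ge0.
- move=> x y; rewrite -lerBlDl (le_trans (ler_norm _))//.
  have [xr|xr] := leP (mdist x point) r; first exact: step.
  have [yr|yr] := leP (mdist y point) r.
    by rewrite distrC metric_sym; exact: step.
  rewrite (wr _ (ltW xr)) (wr _ (ltW yr)) !mul0r subrr normr0.
  by rewrite !mulr_ge0 ?mdist_ge0// addr_ge0// mulr_ge0.
- by rewrite lip0_point mulr0.
by exists k.
Qed.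

(** [mu'] is [mu] composed with multiplication by [w]. It stays in F(M) because this sends [delta x]
    to [w x *: delta x], hence finite combinations to finite combinations. *)
Lemma weight_lipfree l r w (mu : lipfree M) :
  0 <= l -> 0 <= r -> weight l r w ->
  exists mu' : lipfree M,
    forall h (k : lip0 M), (forall x, k x = w x * h x) -> mu' h = mu k.
Proof.
move=> l0 r0 lrw; pose C := l * r + 1.
have C0 : 0 < C by rewrite ltr_wpDl// mulr_ge0.
have /choice[T TP] : forall h, exists k : lip0 M,
    (forall x, k x = w x * h x) /\ `|k| <= C * `|h|.
  by move=> h; have [k] := weight_mul h l0 r0 lrw; exists k.
have Tl : linear T.
  move=> c h k; apply/lip0_eqP => x.
  rewrite (TP _).1 /= !fctE !(TP _).1.
  by rewrite mulrDr /GRing.scale/= mulrCA.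
have phiP : (fun h => mu (T h) : R^o) \in dual_pred (lip0 M).
  apply/mem_set; split => [c h k|]; first by rewrite Tl linearP.
  exists (`|mu| * C) => h; rewrite (le_trans (dual_normP _ _))// -mulrA.
  by rewrite ler_wpM2l ?best_constant_ge0// (TP h).2.
have phiF : MkDual phiP \in lipfree_pred M.
  apply/mem_set/closed_spanP => e e0.
  have [n [c [x [_ me]]]] :=
    (lipfree_onP _ _).1 (@lipfree_onT _ _ mu) _ (divr_gt0 e0 C0).
  set nu : lipfree M := \sum_(i < n) c i *: delta (x i) in me.
  pose nu' : lipfree M := \sum_(i < n) (c i * w (x i)) *: delta (x i).
  exists (lipfree_val nu').
    exists n, (fun i => c i * w (x i)), (fun i => eval_lip0 (x i)).
    split; first by move=> i; exists (x i).
    by rewrite -[lipfree_val _]/(val _) raddf_sum.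
  apply: (@le_lt_trans _ _ (`|mu - nu| * C)); last by rewrite -ltr_pdivlMr.
  apply: dual_norm_le; first by rewrite mulr_ge0// ltW.
  move=> h; have -> : (MkDual phiP - lipfree_val nu') h = (mu - nu) (T h).
    rewrite -[LHS]/(mu (T h) - nu' h) -[RHS]/(mu (T h) - nu (T h)).
    rewrite !lipfree_sumE; congr (_ - _); apply: eq_bigr => i _.
    by rewrite (TP h).1 mulrA.
  rewrite (le_trans (dual_normP _ _))// -mulrA.
  by rewrite ler_wpM2l ?best_constant_ge0// (TP h).2.
exists (MkFree phiF) => h k kE /=; congr (dual_fun _ _).
by apply/lip0_eqP => x; rewrite (TP h).1 kE.
Qed.

End weights.

(** * Supports of images under the linearization *)

Section supports_under_linearization.
Context {R : realType} {M N : completePointedMetricType R}.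
Variables (f : M -> N) (f0 : Lip0 f).
Implicit Types (gamma : lipfree M).

Lemma fhat0 : fhat f 0 = 0.
Proof. by apply/lipfree_eqP => h; rewrite (fhatE f0). Qed.

Lemma supp0 : supp (0 : lipfree M) = set0.
Proof.
rewrite -subset0 => x; apply; split; first exact: closed0.
by apply: subset_closure; exact: lin_span0.
Qed.

Lemma supp_eq0 gamma : supp gamma = set0 -> gamma = 0.
Proof. by move=> g0; apply/lipfree_eqP => h; rewrite supp_null// g0. Qed.

Lemma supp_fhat_sub gamma : supp (fhat f gamma) `<=` closure (f @` supp gamma).
Proof.
move=> y; apply; split; first exact: closed_closure.
apply: annihilator_lipfree_on => h hK; rewrite (fhatE f0); apply: supp_null.
by move=> x gx; apply: hK; apply: subset_closure; exists x.
Qed.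

Lemma supp_fhat_sup gamma : injective (fhat f) ->
  metric_bounded (supp gamma) -> f @` supp gamma `<=` supp (fhat f gamma).
Proof.
move=> finj [b bP] _ [x gx <-].
apply: contrapT => /notin_supp[K [Kg [r r0 rK]]].
have [[k0 fk0] fp] := f0.
pose k := Num.max 1 k0.
have k_ge1 : 1 <= k by rewrite le_max lexx.
have fk y z : mdist (f y) (f z) <= k * mdist y z.
  by rewrite (le_trans (fk0 _ _))// ler_wpM2r ?mdist_ge0// le_max lexx orbT.
(* With this slope [g] is 1 within [r / 2] of [f x] and 0 from distance [r] on. *)
pose L := 2 / r; have L0 : 0 < L by rewrite divr_gt0.
pose g : N -> R := bump 2 L (f x).
have gr : weight L (r + mdist (f x) point) g.
  split => [|||z zr];
    [exact/bump_lipbound/ltW|exact: bump_ge0|exact: bump_le1|].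
  apply: bump0; rewrite mulrAC ler_pdivlMr// ler_wpM2l//.
  have := metric_triangle z (f x) point; rewrite (metric_sym z (f x)).
  by move: zr; lra.
have b0 : 0 <= b by rewrite (le_trans _ (bP x x gx gx))// mdist_ge0.
(* The cutoff [bump rad 1 point] is 1 up to distance [rad - 1], which covers both the support and
   the unit ball about [x]. *)
pose rad := mdist point x + b + 2.
pose w y := Num.min (bump rad 1 point y) (g (f y)).
have wr : weight (Num.max 1 (L * k)) rad w.
  split=> [|y|y|y yr].
  - apply: lipbound_min.
      by apply: lipboundW (bump_lipbound _ _ ler01); rewrite le_max lexx.
    apply: (@lipboundW _ _ (L * k)); first by rewrite le_max lexx orbT.
    move=> y z; rewrite (le_trans (weight_lip gr (f y) (f z)))// lerD2l.
    by rewrite -(mulrA L) ler_wpM2l// ltW.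
  - by rewrite le_min !bump_ge0.
  - by rewrite ge_min bump_le1.
  - by rewrite /w bump0 ?mul1r 1?metric_sym// (min_idPl _)// bump_ge0.
have w1 y : bump rad 1 point y = 1 -> w y = g (f y).
  by move=> E; rewrite /w E; apply/min_idPr; exact: bump_le1.
have ws y : supp gamma y -> w y = g (f y).
  move=> gy; apply/w1/bump1; rewrite mul1r /rad.
  by have := metric_triangle point x y; have := bP x y gx gy; lra.
have [||gamma' g'P] := @weight_lipfree _ _ _ _ _ gamma _ _ wr.
- by rewrite le_max ler01.
- by rewrite !addr_ge0// mdist_ge0.
have g'0 : gamma' = 0.
  apply: finj; rewrite fhat0; apply/lipfree_eqP => h.
  have [||k1 k1E _] := weight_mul (comp_lip0 f0 h) _ _ wr.
  - by rewrite le_max ler01.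
  - by rewrite !addr_ge0// mdist_ge0.
  have [||k2 k2E _] := weight_mul h _ _ gr; first exact: ltW.
    by rewrite addr_ge0 ?mdist_ge0// ltW.
  (* [k2] is the product of [g] and [h], and [g] vanishes on [K], which misses the ball of radius
     [r] about [f x]. *)
  have gk2 : gamma (comp_lip0 f0 k2) = 0.
    rewrite -fhatE; apply: (lipfree_on_eq0 Kg) => z [Kz|->]; last first.
      exact: lip0_point.
    rewrite k2E /g bump0 ?mul0r// mulrAC ler_pdivlMr// ler_wpM2l//.
    by rewrite leNgt; apply/negP => xz; apply: (rK z) Kz; rewrite ballEmdist.
  (* On [supp gamma] the functions [k1] and [k2 \o f] coincide. *)
  rewrite (fhatE f0) (g'P _ _ k1E) -[LHS]subr0 -gk2 -lipfreeB.
  rewrite supp_null// => y gy.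
  by rewrite lip0B k1E ws//= k2E subrr.
(* On [ball x s] the weight is 1: [s <= 1] takes care of the cutoff and [k * s <= r / 2] of
   [g (f y)]. *)
pose s := Num.min 1 (r / (2 * k)).
have s0 : 0 < s.
  by rewrite lt_min ltr01 divr_gt0// mulr_gt0// (lt_le_trans ltr01).
(* This closed set misses [x], yet [gamma] lies in its free space: if [h] vanishes on it, then [w]
   times [h] is [h], so [gamma h = gamma' h = 0]. *)
have : (~` (ball x s)°) x; last by apply; exact: nbhsx_ballx.
apply: gx; split; first by apply: open_closedC; exact: open_interior.
apply: annihilator_lipfree_on => h hs.
rewrite -(g'P h) ?g'0// => y.
have [/interior_subset xy|xy] := pselect ((ball x s)° y); last first.
  by rewrite hs// mulr0.
rewrite ballEmdist/= lt_min in xy; case/andP: xy => xy1 xyr.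
rewrite w1; last first.
  apply: bump1; rewrite mul1r /rad.
  by have := metric_triangle point x y; lra.
rewrite /g bump1 ?mul1r//.
rewrite [leRHS](_ : _ = 1); last by ring.
rewrite mulrAC ler_pdivrMr// mul1r mulrC -ler_pdivlMr//.
rewrite (le_trans (fk x y))// mulrC -ler_pdivlMr ?(lt_le_trans ltr01)//.
by rewrite -mulrA -invfM ltW.
Qed.

End supports_under_linearization.

Theorem corollary2p7 (R : realType) (M N : completePointedMetricType R)
    (f : M -> N) (hf : Lip0 f) :
  (injective (fhat f) ->
     forall gamma : lipfree M,
       metric_bounded (supp gamma) -> preserves_support f gamma) /\
  (metric_bounded [set: M] ->
     (injective (fhat f) <-> preserves_supports f)).
Proof.
have bounded_case : injective (fhat f) -> forall gamma : lipfree M,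
    metric_bounded (supp gamma) -> preserves_support f gamma.
  move=> finj gamma gb; apply/seteqP; split; first exact: supp_fhat_sub.
  rewrite [X in _ `<=` X](closure_id _).1; last exact: supp_closed.
  by apply: closureS; exact: supp_fhat_sup.
split=> // -[b Mb]; split => [finj gamma|fs mu nu munu].
  by apply: bounded_case => //; exists b => x y _ _; exact: Mb.
have [fl _ _] := fhat_is_linearization hf.
(* The image of [mu - nu] is 0, whose support is empty; preservation then leaves no point in the
   support of [mu - nu]. *)
apply/eqP; rewrite -subr_eq0; apply/eqP/supp_eq0.
have := fs (mu - nu); rewrite /preserves_support.
have -> : fhat f (mu - nu) = 0.
  by rewrite -[mu - nu]addrC -scaleN1r fl munu scaleN1r addNr.
rewrite supp0 => /esym c0; rewrite -subset0 => x gx.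
have : closure (f @` supp (mu - nu)) (f x) by apply: subset_closure; exists x.
by rewrite c0.
Qed.
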